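(* Let $n\geq 3$ be an odd integer and let $a_{k1}$ ($1\le k\le n-1$) and $a_{k0}$ ($n+1\le k\le 2n-1$) be real numbers. Consider the system $$\dot x=-y+y\sum_{k=1}^{n-1}a_{k1}x^k+\sum_{k=n+1}^{2n-1}a_{k0}x^k,\qquad \dot y=x^{2n-1}.$$ If this system admits a formal inverse integrating factor $V(x,y)$, then either $a_{k0}=0$ for all $k=n+1,\dots,2n-1$, or the $(1,n)$-quasi-homogeneous part of weighted degree $2n$ of $V(x,y)$ is zero.
   Context: Let $X$ be the vector field of the system. A formal inverse integrating factor is a formal power series $V(x,y)\in\mathbb{R}[[x,y]]$ satisfying $XV=V\operatorname{div}X$ as formal power series, where $XV=\dot x\,\partial V/\partial x+\dot y\,\partial V/\partial y$. Writing $V=\sum_{i,j\ge0}q_{ij}x^iy^j$, its $(1,n)$-quasi-homogeneous part of weighted degree $k$ is $\sum_{i+nj=k}q_{ij}x^iy^j$. *)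

(* Defs.v *)
From HB Require Import structures.
From mathcomp Require Import all_boot all_order all_algebra.
From mathcomp Require Import reals.

Set Implicit Arguments.
Unset Strict Implicit.
Unset Printing Implicit Defensive.

Import Order.TTheory GRing.Theory Num.Theory.
Local Open Scope ring_scope.

Section FormalSeries.
Variable R : comNzRingType.

(* An element q of R[[x, y]] is its coefficient family: q i j is the
   coefficient of x^i y^j.  Equality of series is pointwise (=2). *)
Definition fps2 : Type := nat -> nat -> R.

Definition fps2_zero : fps2 := fun _ _ => 0.

Definition fps2_add (f g : fps2) : fps2 := fun i j => f i j + g i j.

Definition fps2_mul (f g : fps2) : fps2 := fun i j =>
  \sum_(k < i.+1) \sum_(l < j.+1) f k l * g (i - k)%N (j - l)%N.

Definition fps2_dx (f : fps2) : fps2 := fun i j => f i.+1 j *+ i.+1.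

Definition fps2_dy (f : fps2) : fps2 := fun i j => f i j.+1 *+ j.+1.

(* Bivariate polynomials follow the polyXY convention: in {poly {poly R}} the
   outer indeterminate 'X is x and the constant 'X%:P is y. *)
Definition fps2_of_poly (p : {poly {poly R}}) : fps2 := fun i j => p`_i`_j.

(* A planar polynomial vector field, dx/dt = vf.1 and dy/dt = vf.2. *)
Definition vfield : Type := ({poly {poly R}} * {poly {poly R}})%type.

Definition vf_apply (X : vfield) (V : fps2) : fps2 :=
  fps2_add (fps2_mul (fps2_of_poly X.1) (fps2_dx V))
           (fps2_mul (fps2_of_poly X.2) (fps2_dy V)).

Definition vf_div (X : vfield) : fps2 :=
  fps2_add (fps2_dx (fps2_of_poly X.1)) (fps2_dy (fps2_of_poly X.2)).

Definition formal_inverse_integrating_factor (X : vfield) (V : fps2) : Prop :=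
  vf_apply X V =2 fps2_mul V (vf_div X).

Definition qh_part (s t k : nat) (V : fps2) : fps2 := fun i j =>
  if (s * i + t * j == k)%N then V i j else 0.

End FormalSeries.

Arguments fps2_zero {R}.

(* a1 k and a0 k stand for a_{k1} and a_{k0}; only the indices occurring in
   the sums, 1 <= k <= n-1 and n+1 <= k <= 2n-1 respectively, matter. *)
Definition nilpotent_system (R : comNzRingType) (n : nat) (a1 a0 : nat -> R) :
    vfield R :=
  let x : {poly {poly R}} := 'X in
  let y : {poly {poly R}} := 'X%:P in
  let c (r : R) : {poly {poly R}} := r%:P%:P in
  (- y + y * (\sum_(1 <= k < n) c (a1 k) * x ^+ k)
     + \sum_(n.+1 <= k < 2 * n) c (a0 k) * x ^+ k,
   x ^+ (2 * n - 1)).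

(* Main.v *)
(* Write V = v0(x) + v1(x) y + v2(x) y^2 + ..., B = sum a_{k0} x^k and
   G = 1 - sum a_{k1} x^k.  The coefficients of y^0, y^1, y^2 in
   XV = V div X read
     B v0' - v0 B' + x^(2n-1) v1 = 0,
     G v0' - v0 G' = B v1' - v1 B' + 2 x^(2n-1) v2,
     G v1' - v1 G' = B v2' - v2 B' + 3 x^(2n-1) v3.
   Suppose B = b x^k + ... with b <> 0 and n < k < 2n.  Comparing orders gives
   v0 = c x^(2n) + ..., v1 = O(x^k) and v2 = n c + ..., so the part of weighted
   degree 2n is c (x^(2n) + n y^2).  The first equation then forces
   [x^k] v1 = (k - 2n) b c and the third one [x^k] v1 = - n b c, hence c = 0. *)
Require Import Defs.
From HB Require Import structures.
From mathcomp Require Import all_boot all_order all_algebra.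
From mathcomp Require Import reals.
From mathcomp Require Import zify ring.

Set Implicit Arguments.
Unset Strict Implicit.
Unset Printing Implicit Defensive.

Import Order.TTheory GRing.Theory Num.Theory.
Local Open Scope ring_scope.

(** * Orders and leading coefficients of products and Wronskians of power series in x *)

Definition conv (R : pzSemiRingType) (f g : nat -> R) (m : nat) : R :=
  \sum_(k < m.+1) f k * g (m - k)%N.

Definition deriv_seq (R : nmodType) (f : nat -> R) (i : nat) : R :=
  f i.+1 *+ i.+1.

Definition vanishes_below (R : nmodType) (p : nat) (f : nat -> R) : Prop :=
  forall i, (i < p)%N -> f i = 0.

Lemma conv_lead (R : pzSemiRingType) (p q : nat) (f g : nat -> R) :
  vanishes_below p f -> vanishes_below q g -> conv f g (p + q) = f p * g q.
Proof.
move=> f0 g0; have lt_p : (p < (p + q).+1)%N by lia.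
rewrite /conv (bigD1 (Ordinal lt_p)) //= addKn big1 ?addr0 // => i ne_ip.
have {}ne_ip : i != p :> nat by [].
case: (ltnP i p) => [/f0 -> | le_pi]; first by rewrite mul0r.
by rewrite g0 ?mulr0 //; have := ltn_ord i; lia.
Qed.

Lemma vanishes_below_conv (R : pzSemiRingType) (p q : nat) (f g : nat -> R) :
  vanishes_below p f -> vanishes_below q g -> vanishes_below (p + q) (conv f g).
Proof.
move=> f0 g0 m lt_m; rewrite /conv big1 // => i _.
case: (ltnP i p) => [/f0 -> | le_pi]; first by rewrite mul0r.
by rewrite g0 ?mulr0 //; have := ltn_ord i; lia.
Qed.

(** Trades [g'] for [x g'] at the cost of one degree: the Euler operator never lowers the order, so
    the two product lemmas apply to it directly. *)
Lemma conv_deriv (R : pzSemiRingType) (f g : nat -> R) (m : nat) :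
  conv f (deriv_seq g) m = conv f (fun i => g i *+ i) m.+1.
Proof.
rewrite /conv [RHS]big_ord_recr /= subnn mulr0n mulr0 addr0.
by apply: eq_bigr => i _; rewrite subSn // -ltnS.
Qed.

Definition wronskian (R : pzRingType) (f g : nat -> R) (m : nat) : R :=
  conv f (deriv_seq g) m - conv g (deriv_seq f) m.

Lemma wronskian_lead (R : comPzRingType) (p q m : nat) (f g : nat -> R) :
    vanishes_below p f -> vanishes_below q g -> (p + q = m.+1)%N ->
  wronskian f g m = f p * g q * (q%:R - p%:R).
Proof.
move=> f0 g0 pqm; rewrite /wronskian !conv_deriv -pqm {2}addnC !conv_lead //.
- by rewrite -[g q *+ q]mulr_natr -[f p *+ p]mulr_natr; ring.
- by move=> i /f0 ->; rewrite mul0rn.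
- by move=> i /g0 ->; rewrite mul0rn.
Qed.

Lemma vanishes_below_wronskian (R : comPzRingType) (p q : nat) (f g : nat -> R) :
    vanishes_below p f -> vanishes_below q g ->
  vanishes_below (p + q).-1 (wronskian f g).
Proof.
move=> f0 g0 m lt_m; rewrite /wronskian !conv_deriv.
rewrite (@vanishes_below_conv _ p q f) ?(@vanishes_below_conv _ q p g) ?subrr //;
  try lia.
- by move=> i /f0 ->; rewrite mul0rn.
- by move=> i /g0 ->; rewrite mul0rn.
Qed.

(* [wronskian g v = g^2 (v / g)'], so it determines the order of [v]. *)
Lemma vanishes_below_of_wronskian (R : numDomainType) (q : nat) (g v : nat -> R) :
    g 0%N != 0 -> v 0%N = 0 -> vanishes_below q (wronskian g v) ->
  vanishes_below q.+1 v.
Proof.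
move=> g0 v0 W0.
suff IH m : (m <= q)%N -> vanishes_below m.+1 v by exact: IH.
(* The base case must be assumed: the Wronskian kills constant multiples of [g], so it cannot detect
   [v 0]. *)
elim: m => [_ [|//] _ // | m IHm lt_mq].
move=> i; rewrite ltnS leq_eqVlt => /predU1P[-> | ]; last exact: IHm (ltnW _) _.
have := @wronskian_lead _ 0 m.+1 m g v (fun _ => ltac:(by [])) (IHm (ltnW lt_mq)) erefl.
rewrite W0 // subr0 => /esym/eqP.
by rewrite !mulf_eq0 (negPf g0) pnatr_eq0 /= orbF => /eqP.
Qed.

(** * The equation for V, read power by power in y *)

Lemma fps2_mul_conv (R : comNzRingType) (f g : fps2 R) (i j : nat) :
  fps2_mul f g i j = \sum_(l < j.+1) conv (f^~ l) (g^~ (j - l)%N) i.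
Proof. by rewrite /fps2_mul exchange_big. Qed.

(** Since [Q] is free of y, the divergence is just the x-derivative of [P], so its terms pair with
    those of [P V_x] into Wronskians; [Q V_y] leaves one product. *)
Lemma inverse_integrating_factor_row (R : comNzRingType) (X : vfield R)
    (V : fps2 R) (P := fps2_of_poly X.1) (Q := fps2_of_poly X.2) (j m : nat) :
    (forall i l, Q i l.+1 = 0) -> formal_inverse_integrating_factor X V ->
  \sum_(l < j.+1) wronskian (P^~ l) (V^~ (j - l)%N) m
    + conv (Q^~ 0%N) (V^~ j.+1) m *+ j.+1 = 0.
Proof.
move=> Q0 /(_ m j); rewrite /vf_apply /fps2_add !fps2_mul_conv -/P -/Q => E.
have convQ : \sum_(l < j.+1) conv (Q^~ l) ((fps2_dy V)^~ (j - l)%N) m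
    = conv (Q^~ 0%N) (V^~ j.+1) m *+ j.+1.
  rewrite big_ord_recl subn0 big1 ?addr0 => [|l _]; last first.
    by rewrite /conv big1 // => k _; rewrite lift0 /= Q0 mul0r.
  by rewrite /conv -sumrMnl; apply: eq_bigr => k _; rewrite mulrnAr.
have convdiv : \sum_(l < j.+1) conv (V^~ l) ((vf_div X)^~ (j - l)%N) m
    = \sum_(l < j.+1) conv (V^~ (j - l)%N) (deriv_seq (P^~ l)) m.
  (* Reversing [l] to [j - l] aligns this sum with the one from [P V_x]. *)
  rewrite (reindex_inj rev_ord_inj); apply: eq_bigr => l _ /=; rewrite subSS subKn.
    apply: eq_bigr => k _; congr (_ * _).
    by rewrite /vf_div /fps2_add /fps2_dy -/Q Q0 mul0rn addr0.
  by rewrite -ltnS.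
by rewrite sumrB -convQ -convdiv addrAC E subrr.
Qed.

(** The columns of the x-component are B, -G and 0. For -G the constant term suffices: being
    nonzero, it lets Wronskians with G control orders. *)
Lemma nilpotent_system_xdotE (R : comNzRingType) (n : nat) (a1 a0 : nat -> R)
    (P := fps2_of_poly (nilpotent_system n a1 a0).1) :
  [/\ forall i, P i 0%N = (if (n < i < 2 * n)%N then a0 i else 0),
      P 0%N 1%N = - 1 & forall i j, P i j.+2 = 0].
Proof.
have coef_sum m p (a : nat -> R) i : (\sum_(m <= k < p) (a k)%:P%:P * 'X^k)`_i
    = (if (m <= i < p)%N then a i else 0)%:P :> {poly R}.
  rewrite coef_sum; under eq_bigr do rewrite coefCM coefXn.
  case: ifP => [i_in | i_out].
    rewrite (bigD1_seq i) ?mem_index_iota ?iota_uniq //= eqxx mulr1 big1 ?addr0 //.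
    by move=> k /negPf ne_ki; rewrite eq_sym ne_ki mulr0.
  rewrite big_seq big1 // => k; rewrite mem_index_iota => k_in.
  by case: eqP i_out => [-> | _ _]; rewrite ?k_in ?mulr0.
have PE i j : P i j = - (if i == 0%N then (j == 1%N)%:R else 0)
    + (if j == 0%N then 0 else (if (1 <= i < n)%N then a1 i else 0) *+ (j == 1%N))
    + (if j == 0%N then if (n < i < 2 * n)%N then a0 i else 0 else 0).
  rewrite /P /fps2_of_poly /nilpotent_system /= !coefD !coefN !coefC coefCM !coef_sum.
  rewrite coefXM !coefC.
  congr (- _ + _ + _); first by case: eqP => _; rewrite ?coefX ?coef0.
  by case: j => [|[|j]].
by split=> [i||i j]; rewrite PE /= ?if_same ?oppr0 ?add0r ?addr0.
Qed.

Lemma nilpotent_system_ydotE (R : comNzRingType) (n : nat) (a1 a0 : nat -> R)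
    (i j : nat) :
  fps2_of_poly (nilpotent_system n a1 a0).2 i j
    = ((i == 2 * n - 1)%N && (j == 0%N))%:R.
Proof.
rewrite /fps2_of_poly /= coefXn; case: eqP => _ /=; last by rewrite coef0.
by rewrite coef1.
Qed.

(** * The part of weight 2n *)

Lemma weight_2n_monomials (n i j : nat) :
  (3 <= n)%N -> (1 * i + n * j = 2 * n)%N ->
  [\/ (i, j) = ((2 * n)%N, 0%N), (i, j) = (n, 1%N) | (i, j) = (0%N, 2%N)].
Proof.
move=> n3; case: j => [|[|[|j]]] ij; last by nia.
- by constructor 1; congr (_, _); lia.
- by constructor 2; congr (_, _); lia.
- by constructor 3; congr (_, _); lia.
Qed.

(** Here [k] is the order of B. The order bounds are bootstrapped: v0 of order at least [k] gives
    v1(0) = 0, hence v1 of order at least [k], which in turn raises the order of v0 to 2n. *)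
Lemma qh_part_2n_eq0 (R : numDomainType) (n k : nat) (a1 a0 : nat -> R) (V : fps2 R) :
    (3 <= n)%N -> (n < k < 2 * n)%N -> a0 k != 0 ->
    (forall i, (n < i < k)%N -> a0 i = 0) ->
    formal_inverse_integrating_factor (nilpotent_system n a1 a0) V ->
  qh_part 1 n (2 * n) V =2 fps2_zero.
Proof.
move=> n3 /andP[lt_nk lt_k2n] b0 a0_lt hV.
set P := fps2_of_poly (nilpotent_system n a1 a0).1.
set Q := fps2_of_poly (nilpotent_system n a1 a0).2.
have [P0E P01 P2] : [/\ forall i, P i 0%N = (if (n < i < 2 * n)%N then a0 i else 0),
  P 0%N 1%N = - 1 & forall i j, P i j.+2 = 0] by exact: nilpotent_system_xdotE.
have QE i j : Q i j = ((i == 2 * n - 1)%N && (j == 0%N))%:R.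
  exact: nilpotent_system_ydotE.
have Qy i l : Q i l.+1 = 0 by rewrite QE andbF.
have rowE j m := inverse_integrating_factor_row j m Qy hV.
have any0 (f : nat -> R) : vanishes_below 0 f by [].
have P0 : vanishes_below k (P^~ 0%N).
  move=> i lt_ik; rewrite P0E; case: ifP => // /andP[lt_ni _].
  by rewrite a0_lt // lt_ni.
have P0k : P k 0%N = a0 k by rewrite P0E lt_nk lt_k2n.
have P1n0 : P 0%N 1%N != 0 by rewrite P01 oppr_eq0 oner_eq0.
have Q0 : vanishes_below (2 * n - 1) (Q^~ 0%N).
  by move=> i lt_i; rewrite QE ltn_eqF.
have Qlead : Q (2 * n - 1)%N 0%N = 1 by rewrite QE !eqxx.
have row0 m : wronskian (P^~ 0%N) (V^~ 0%N) m + conv (Q^~ 0%N) (V^~ 1%N) m = 0.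
  by have := rowE 0%N m; rewrite big_ord1.
have row1 m : wronskian (P^~ 0%N) (V^~ 1%N) m + wronskian (P^~ 1%N) (V^~ 0%N) m
    + conv (Q^~ 0%N) (V^~ 2%N) m *+ 2 = 0.
  by have := rowE 1%N m; rewrite big_ord_recr big_ord1.
have row2 m : wronskian (P^~ 0%N) (V^~ 2%N) m + wronskian (P^~ 1%N) (V^~ 1%N) m
    + conv (Q^~ 0%N) (V^~ 3%N) m *+ 3 = 0.
  have := rowE 2%N m; rewrite !big_ord_recr big_ord0 /= add0r.
  suff -> : wronskian (P^~ 2%N) (V^~ 0%N) m = 0 by rewrite addr0.
  rewrite /wronskian /conv /deriv_seq !big1 ?subrr // => i _.
    by rewrite P2 mul0rn mulr0.
  by rewrite P2 mul0r.
have V00 : V 0%N 0%N = 0.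
  (* At this degree B v0' - v0 B' contributes -k b v0(0), and x^(2n-1) v1 has not started yet. *)
  have := row0 k.-1.
  rewrite (wronskian_lead P0 (any0 _)); last by lia.
  rewrite (vanishes_below_conv Q0 (any0 _)) ?addr0; last by lia.
  move/eqP; rewrite sub0r mulrN oppr_eq0 !mulf_eq0 P0k (negPf b0) pnatr_eq0.
  by rewrite gtn_eqF ?orbF => [/eqP | ]; last by lia.
have V0k : vanishes_below k (V^~ 0%N).
  rewrite -(@prednK k); last by lia.
  apply: (vanishes_below_of_wronskian (g := P^~ 1%N)) => // m lt_m; have := row1 m.
  rewrite (vanishes_below_wronskian P0 (any0 _)); last by lia.
  rewrite (vanishes_below_conv Q0 (any0 _)); last by lia.
  by rewrite mul0rn add0r addr0.
have V10 : V 0%N 1%N = 0.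
  (* The Wronskian starts at degree 2k-1 or later, beyond 2n-1 because [n < k]; only v1(0)
     remains. *)
  have := row0 (2 * n - 1)%N.
  rewrite (vanishes_below_wronskian P0 V0k); last by lia.
  rewrite -[X in conv _ _ X]addn0 (conv_lead Q0 (any0 _)).
  by rewrite Qlead mul1r add0r.
have V1k : vanishes_below k (V^~ 1%N).
  rewrite -(@prednK k); last by lia.
  apply: (vanishes_below_of_wronskian (g := P^~ 1%N)) => // m lt_m; have := row2 m.
  rewrite (vanishes_below_wronskian P0 (any0 _)); last by lia.
  rewrite (vanishes_below_conv Q0 (any0 _)); last by lia.
  by rewrite mul0rn add0r addr0.
have V02n : vanishes_below (2 * n) (V^~ 0%N).
  rewrite -(@prednK (2 * n)); last by lia.
  apply: (vanishes_below_of_wronskian (g := P^~ 1%N)) => // m lt_m; have := row1 m.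
  (* Again 2k-1 > 2n-1, so v1 does not interfere with the order of v0. *)
  rewrite (vanishes_below_wronskian P0 V1k); last by lia.
  rewrite (vanishes_below_conv Q0 (any0 _)); last by lia.
  by rewrite mul0rn add0r addr0.
have V2E : V 0%N 2%N = n%:R * V (2 * n)%N 0%N.
  have := row1 (2 * n - 1)%N.
  rewrite (vanishes_below_wronskian P0 V1k); last by lia.
  rewrite (wronskian_lead (any0 _) V02n); last by lia.
  rewrite -[X in conv _ _ X]addn0 (conv_lead Q0 (any0 _)) Qlead P01 natrM => E.
  apply: (@mulfI _ 2%:R); first by rewrite pnatr_eq0.
  (* The 0 is replaced by the left side of [E], leaving an identity for [ring]. *)
  by apply/eqP; rewrite -subr_eq0 -[X in _ == X]E; apply/eqP; ring.
have V1kE : V k 1%N = (k%:R - 2 * n%:R) * (a0 k * V (2 * n)%N 0%N).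
  have := row0 (2 * n - 1 + k)%N.
  rewrite (wronskian_lead P0 V02n); last by lia.
  rewrite (conv_lead Q0 V1k) Qlead P0k natrM => E.
  by apply/eqP; rewrite -subr_eq0 -[X in _ == X]E; apply/eqP; ring.
have V1kE_row2 : V k 1%N = - (a0 k * V 0%N 2%N).
  (* Both Wronskians carry the factor [k], which is cancelled below. *)
  have := row2 k.-1.
  rewrite (wronskian_lead P0 (any0 _)); last by lia.
  rewrite (wronskian_lead (any0 _) V1k); last by lia.
  rewrite (vanishes_below_conv Q0 (any0 _)); last by lia.
  rewrite P0k P01 => E; apply: (@mulIf _ k%:R); first by rewrite pnatr_eq0; lia.
  by apply/eqP; rewrite -subr_eq0 -[X in _ == X]oppr0 -[X in _ == - X]E; apply/eqP; ring.
have c0 : V (2 * n)%N 0%N = 0.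
  (* Equating the two values of [x^k] v1 gives (k - 2n) b c + n b c = (k - n) b c = 0. *)
  have kn : k%:R - n%:R != 0 :> R by rewrite subr_eq0 eqr_nat; lia.
  move/eqP: V1kE_row2; rewrite V1kE V2E -subr_eq0.
  rewrite (_ : _ - _ = (k%:R - n%:R) * (a0 k * V (2 * n)%N 0%N)); last by ring.
  by rewrite !mulf_eq0 (negPf kn) (negPf b0) => /eqP.
move=> i j; rewrite /qh_part /fps2_zero; case: eqP => // /weight_2n_monomials.
(* The monomial x^n y is absent from V because v1 has order at least [k > n]. *)
by case=> // -[-> ->]; rewrite ?V2E ?c0 ?mulr0 ?V1k.
Qed.

Theorem theorem8 (R : realType) (n : nat) (hn3 : (3 <= n)%N) (hodd : odd n)
    (a1 a0 : nat -> R) (V : fps2 R)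
    (hV : formal_inverse_integrating_factor (nilpotent_system n a1 a0) V) :
  (forall k : nat, (n.+1 <= k <= 2 * n - 1)%N -> a0 k = 0) \/
  qh_part 1 n (2 * n) V =2 fps2_zero.
Proof.
case: (boolP [exists k : 'I_(2 * n), (n < k)%N && (a0 k != 0)]) => [exk | nexk].
  have {}exk : exists k, (n < k < 2 * n)%N && (a0 k != 0).
    by case/existsP: exk => k /andP[nk k0]; exists k; rewrite nk ltn_ord.
  (* The least such index is the order of B. *)
  right; case: (ex_minnP exk) => k /andP[k_in k0] k_min.
  apply: (qh_part_2n_eq0 hn3 k_in k0 _ hV) => i /andP[lt_ni lt_ik].
  apply: contraTeq (lt_ik) => i0; rewrite -leqNgt k_min // i0 andbT.
  by have /andP[_ lt_k] := k_in; rewrite lt_ni (ltn_trans lt_ik).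
left=> k /andP[lt_nk le_k]; have lt_k : (k < 2 * n)%N by lia.
by move/existsPn/(_ (Ordinal lt_k)): nexk; rewrite /= lt_nk negbK => /eqP.
Qed.
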